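(* Let $\mu=\mu_1\otimes\dots\otimes\mu_d$ be a product probability measure on $\mathbb{R}^d$, and let $f,g:\mathbb{R}^d\to\mathbb{R}$ be functions satisfying the standing integrability assumptions given in the context. (1) Assume that for $1\le i\le d$ the marginals $\mu_i$ are even and log-concave. Let $f=e^{-\phi}$ be an unconditional positive log-concave function and let $g$ be a coordinatewise convex function on $\mathbb{R}^d$. Then $$\mathrm{Cov}_\mu(f,g)\le 0.$$ (2) Assume that $f$ and $g$ are both unconditional and coordinatewise quasi-concave. Then $$\mathrm{Cov}_\mu(f,g)\ge 0.$$
   Context: $\mathrm{Cov}_\mu(f,g)=\int (f-\int f\,d\mu)(g-\int g\,d\mu)\,d\mu$. A measure on $\mathbb{R}$ is even if it is invariant under $x\mapsto -x$, and log-concave if it has a log-concave density with respect to Lebesgue measure. A positive function $f=e^{-\phi}$ is log-concave if $\phi$ is convex. A function $f:\mathbb{R}^d\to\mathbb{R}$ is unconditional if $f(x_1,\dots,x_d)=f(\varepsilon_1x_1,\dots,\varepsilon_dx_d)$ for all $x\in\mathbb{R}^d$ and all signs $(\varepsilon_1,\dots,\varepsilon_d)\in\{-1,1\}^d$. A function on $\mathbb{R}^d$ is coordinatewise convex (resp. coordinatewise quasi-concave) if, for each $i$ and each fixed value of the other coordinates, it is a convex (resp. quasi-concave) function of $x_i\in\mathbb{R}$; a function $h:\mathbb{R}\to\mathbb{R}$ is quasi-concave if $h(\lambda x+(1-\lambda)y)\ge\min\{h(x),h(y)\}$ for all $x,y\in\mathbb{R}$, $\lambda\in[0,1]$. Standing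 assumptions of the paper: $f,g\in L^2(\mu)$, and all the first and second partial derivatives of $f$ and $g$ are integrable with respect to $\mu$; marginals admit a second moment when needed; all functions have enough integrability and regularity for all written quantities to be well defined. *)

(* Defs.v *)
From HB Require Import structures.
From mathcomp Require Import all_boot all_order all_algebra.
From mathcomp Require Import all_classical all_reals all_analysis.

Set Implicit Arguments.
Unset Strict Implicit.
Unset Printing Implicit Defensive.

Import Order.TTheory GRing.Theory Num.Theory.
Import numFieldNormedType.Exports.

Local Open Scope classical_set_scope.
Local Open Scope ring_scope.

(* R^d with its Borel sigma-algebra is [d.-tuple (measurableTypeR R)]: the
   library's sigma-algebra on tuples is the one generated by the coordinates. *)

Section Measures.
Context {R : realType}.
Implicit Types (nu : probability (measurableTypeR R) R) (d : nat).

(* The value on rectangles determines [mu] among the probability measures. *)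
Definition is_product_measure d
    (mu : probability (d.-tuple (measurableTypeR R)) R)
    (mu_ : 'I_d -> probability (measurableTypeR R) R) : Prop :=
  forall A : 'I_d -> set (measurableTypeR R), (forall i, measurable (A i)) ->
    mu [set x | forall i, A i (tnth x i)] = (\prod_(i < d) mu_ i (A i))%E.

Definition even_measure nu : Prop :=
  forall A : set (measurableTypeR R), measurable A ->
    nu ((fun x : R => - x) @^-1` A) = nu A.

(* The density is e^(-V) with V convex and valued in ]-oo, +oo], so that it may
   vanish outside an interval (e.g., uniform measures); recall that
   0 * +oo = 0 in [\bar R]. *)
Definition logconcave_measure nu : Prop :=
  exists V : R -> \bar R,
    [/\ forall x, V x != -oo%E,
        forall (x y l : R), 0 <= l <= 1 ->
          (V (l * x + (1 - l) * y)%R <= l%:E * V x + (1 - l)%:E * V y)%E &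
        forall A : set (measurableTypeR R), measurable A ->
          nu A = (\int[lebesgue_measure]_(x in A) expeR (- V x))%E].

End Measures.

Section Functions.
Context {R : realType} {d : nat}.
Implicit Types (f : d.-tuple R -> R) (x : d.-tuple R) (i j : 'I_d).

Definition set_coord x i (t : R) : d.-tuple R :=
  [tuple if j == i then t else tnth x j | j < d].

(* The section of [f] through [x] along the i-th coordinate. *)
Definition section f x i : R -> R := fun t => f (set_coord x i t).

Definition unconditional f : Prop :=
  forall (eps : {ffun 'I_d -> bool}) x,
    f x = f [tuple (-1) ^+ eps i * tnth x i | i < d].

Definition logconcave f : Prop :=
  exists phi : d.-tuple R -> R,
    (forall x y (l : R), 0 <= l <= 1 ->
       phi [tuple l * tnth x i + (1 - l) * tnth y i | i < d] <=
       l * phi x + (1 - l) * phi y) /\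
    (forall x, f x = expR (- phi x)).

Definition coordinatewise_convex f : Prop :=
  forall i x, convex_function [set: R^o] (section f x i).

Definition quasi_concave (h : R -> R) : Prop :=
  forall x y l : R, 0 <= l <= 1 ->
    Num.min (h x) (h y) <= h (l * x + (1 - l) * y).

Definition coordinatewise_quasi_concave f : Prop :=
  forall i x, quasi_concave (section f x i).

Definition has_partial i f : Prop :=
  forall x, derivable (section f x i) (tnth x i) 1.

Definition partial i f : d.-tuple R -> R :=
  fun x => derive1 (section f x i) (tnth x i).

Definition standing_assumptions
    (mu : probability (d.-tuple (measurableTypeR R)) R) f : Prop :=
  [/\ f \in Lfun mu 2%:E,
      forall i, has_partial i f /\
        mu.-integrable setT (EFin \o partial i f) &
      forall i j, has_partial j (partial i f) /\
        mu.-integrable setT (EFin \o partial j (partial i f))].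

End Functions.

(* Main.v *)
From HB Require Import structures.
Require Import Defs.
From mathcomp Require Import all_boot all_order all_algebra.
From mathcomp Require Import all_classical all_reals all_analysis.
From mathcomp Require Import measurable_realfun ring lra.

Set Implicit Arguments.
Unset Strict Implicit.
Unset Printing Implicit Defensive.

Import Order.TTheory GRing.Theory Num.Theory.
Import numFieldNormedType.Exports.

Local Open Scope classical_set_scope.
Local Open Scope ring_scope.

(** Everything rests on a correlation inequality of Harris type
    ([harris_covariance_ge0]), which is part (2), and to which part (1) reduces.

    An unconditional, coordinatewise quasi-concave function is, along each
    coordinate, even and nonincreasing in the absolute value of that coordinate
    ([unconditional_antitone]); two such functions f and g thus vary in the same
    direction along each coordinate.  Let X and Y be independent with law mu and,
    for a set S of coordinates, let Z_S be X with its coordinates in S replaced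
    by those of Y.  Then E[f(X) g(Z_S)] does not increase when a coordinate i is
    added to S: exchanging the i-th coordinates of X and Y preserves the product law
    ([swap_preserving]), and averaging over this exchange writes twice the
    decrease as the expectation of a product of an increment of f and an
    increment of g between the same two values of the i-th coordinate, which is
    nonnegative.  Going from S empty, where Z_S = X, to S full, where Z_S = Y,
    yields E[fg] >= E[f] E[g].  This duplication avoids an induction on the
    dimension.

    For part (1), f is unconditional and mu is invariant under all reflections of
    coordinates, so Cov(f, g o r) = Cov(f, g) for every reflection r.  Hence
    Cov(f, G) = 2^d Cov(f, g) where G is the sum of g o r over all reflections.
    G is unconditional and still coordinatewise convex, so - G satisfies the
    hypotheses of part (2); so does f, a log-concave function being
    quasi-concave.  Hence Cov(f, - G) >= 0.

    Both invariance properties of the product laws follow from the fact that a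
    finite measure is determined by its values on cylinders
    ([eq_measure_cylinders]). *)

(** * Measure-preserving maps *)

Section MeasurePreserving.
Context {R : realType} {d1 d2 : measure_display}.
Context {X : measurableType d1} {Y : measurableType d2}.
Implicit Types F : Y -> \bar R.
Variables (m : {measure set X -> \bar R}) (n : {measure set Y -> \bar R}).

Definition measure_preserving (phi : X -> Y) : Prop :=
  measurable_fun setT phi /\
  forall A : set Y, measurable A -> m (phi @^-1` A) = n A.

Variable phi : X -> Y.
Hypothesis phiP : measure_preserving phi.

Let mphi : measurable_fun setT phi. Proof. by case: phiP. Qed.

Let phi_mfun : {mfun X >-> Y} :=
  HB.pack phi (isMeasurableFun.Build _ _ _ _ _ mphi).

Let integral_pushforwardE F :
  (\int[n]_y F y = \int[pushforward m phi]_y F y)%E.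
Proof.
apply: (eq_measure_integral (pushforward m phi_mfun)) => A mA _.
by rewrite -phiP.2.
Qed.

Lemma measure_preserving_ge0_integral (F : Y -> \bar R) :
  measurable_fun setT F -> (forall y, 0 <= F y)%E ->
  (\int[m]_x F (phi x) = \int[n]_y F y)%E.
Proof.
by move=> mF F0; rewrite integral_pushforwardE ge0_integral_pushforward.
Qed.

Lemma measure_preserving_integrable (F : Y -> \bar R) :
  n.-integrable setT F -> m.-integrable setT (F \o phi).
Proof.
move=> /integrableP[mF iF]; apply/integrableP; split.
  exact: measurableT_comp.
rewrite (measure_preserving_ge0_integral (F := abse \o F))//.
  exact: measurableT_comp.
by move=> y /=; exact: abse_ge0.
Qed.

Lemma measure_preserving_integral (F : Y -> \bar R) :
  n.-integrable setT F -> (\int[m]_x F (phi x) = \int[n]_y F y)%E.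
Proof.
move=> iF; have /integrableP[mF _] := iF.
rewrite integral_pushforwardE integral_pushforward//.
exact: measure_preserving_integrable.
Qed.

Lemma measure_preserving_Lfun1 (F : Y -> R) :
  F \in Lfun n 1 -> F \o phi \in Lfun m 1.
Proof.
move=> /Lfun1_integrable iF; apply/Lfun1_integrable.
exact: (measure_preserving_integrable iF).
Qed.

Lemma measure_preserving_Lfun2 (F : Y -> R) :
  F \in Lfun n 2%:E -> F \o phi \in Lfun m 2%:E.
Proof.
rewrite !inE => /andP[]; rewrite !inE/= => mF.
rewrite /finite_norm unlock /= => lF.
apply/andP; split; rewrite inE/=; first exact: measurableT_comp.
rewrite /finite_norm unlock /=.
rewrite (measure_preserving_ge0_integral
  (F := fun y => (`|F y| `^ 2)%:E))//.
- apply/measurable_EFinP.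
  apply: (@measurableT_comp _ _ _ _ _ _ (fun x : R => x `^ 2)) => //.
  exact: measurableT_comp.
Qed.

End MeasurePreserving.

Lemma measure_preserving_comp (R : realType) d1 d2 d3 (X : measurableType d1)
    (Y : measurableType d2) (Z : measurableType d3)
    (m : {measure set X -> \bar R}) (n : {measure set Y -> \bar R})
    (p : {measure set Z -> \bar R}) (phi : X -> Y) (psi : Y -> Z) :
  measure_preserving m n phi -> measure_preserving n p psi ->
  measure_preserving m p (psi \o phi).
Proof.
move=> [mphi phiE] [mpsi psiE]; split; first exact: measurableT_comp.
move=> A mA; rewrite comp_preimage phiE ?psiE//.
by rewrite -[_ @^-1` _]setTI; exact: mpsi.
Qed.

Lemma Lfun2_Lfun1 (R : realType) d (X : measurableType d)
    (P : probability X R) (f : X -> R) :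
  f \in Lfun P 2%:E -> f \in Lfun P 1.
Proof. by apply: Lfun_subset12; exact: fin_num_measure. Qed.

Lemma covariance_measure_preserving (R : realType) d (X : measurableType d)
    (P : probability X R) (phi : X -> X) (f g : X -> R) :
  measure_preserving P P phi -> f \in Lfun P 2%:E -> g \in Lfun P 2%:E ->
  covariance P (f \o phi) (g \o phi) = covariance P f g.
Proof.
move=> phiP f2 g2.
have f1 := Lfun2_Lfun1 f2.
have g1 := Lfun2_Lfun1 g2.
have fg1 := Lfun2_mul_Lfun1 f2 g2.
rewrite [LHS]covarianceE ?(measure_preserving_Lfun1 phiP)//; last first.
  exact: (measure_preserving_Lfun1 phiP fg1).
have EP (h : X -> R) : h \in Lfun P 1 ->
      ('E_P[h \o phi] = 'E_P[h])%E.
  move=> /Lfun1_integrable ih; rewrite unlock.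
  exact: (measure_preserving_integral phiP ih).
by rewrite [RHS]covarianceE// -(EP f)// -(EP g)// -(EP _ fg1).
Qed.

Lemma Lfun2_addr_closed (R : realType) d (X : measurableType d)
    (m : {measure set X -> \bar R}) : addr_closed (Lfun m 2%:E).
Proof.
have le12 : (1 <= 2%:E :> \bar R)%E by rewrite lee1n.
exact: (Lfun_addr_closed m le12).
Qed.

Lemma Lfun2_sum (R : realType) d (X : measurableType d)
    (m : {measure set X -> \bar R}) (I : finType) (g : I -> X -> R) :
  (forall i, g i \in Lfun m 2%:E) -> \sum_i g i \in Lfun m 2%:E.
Proof.
by have [L0 LD] := Lfun2_addr_closed m; move=> g2; elim/big_ind : _.
Qed.

Lemma covariance_sumr (R : realType) d (X : measurableType d)
    (P : probability X R) (I : finType) (f : X -> R) (g : I -> X -> R) :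
  f \in Lfun P 2%:E -> (forall i, g i \in Lfun P 2%:E) ->
  covariance P f (\sum_i g i) = (\sum_i covariance P f (g i))%E.
Proof.
have [L0 LD] := Lfun2_addr_closed P.
move=> f2 g2.
(* Additivity of the covariance requires the partial sums to be in L2. *)
suff [] : \sum_i g i \in Lfun P 2%:E /\
   covariance P f (\sum_i g i) = (\sum_i covariance P f (g i))%E by [].
elim/big_rec2 : _ => [|i u v _ [v2 vE]]; split.
- exact: L0.
- exact: (covariance_cst_r P f 0).
- exact: LD.
- by rewrite (covarianceDr f2 (g2 i) v2) vE.
Qed.

(** * Uniqueness of measures with given values on cylinders *)

(** The cylinders form a pi-system.  That it generates the sigma-algebra of [T]
    is expressed by the universal property [univ] (maps into [T] are measurable
    as soon as their components are): applied to the identity map from [T] with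
    the sigma-algebra generated by the cylinders, it gives the inclusion of
    sigma-algebras at once, and it is readily available both for tuples and for
    pairs of tuples. *)
Lemma eq_measure_cylinders (R : realType) d0 (T : measurableType d0)
    (I : finType) (h : I -> T -> measurableTypeR R)
    (m n : {measure set T -> \bar R}) :
  (m setT < +oo)%E ->
  (forall i, measurable_fun setT (h i)) ->
  (forall d1 (U : measurableType d1) (k : U -> T),
    (forall i, measurable_fun setT (h i \o k)) -> measurable_fun setT k) ->
  (forall A : I -> set (measurableTypeR R), (forall i, measurable (A i)) ->
    m [set x | forall i, A i (h i x)] = n [set x | forall i, A i (h i x)]) ->
  forall E, measurable E -> m E = n E.
Proof.
move=> mfin mh univ mn E mE.
pose G : set (set T) := [set B | exists2 A : I -> set (measurableTypeR R),
  forall i, measurable (A i) & B = [set x | forall i, A i (h i x)]].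
have GT : G setT.
  by exists (fun=> setT) => //; apply/seteqP; split.
apply: (@g_sigma_algebra_measure_unique _ _ _ G _ (fun=> setT)) => //.
- move=> _ [A mA ->].
  rewrite (_ : [set x | _] = \bigcap_(i in [set: I]) (h i @^-1` A i)).
    apply: fin_bigcap_measurable => // i _.
    by rewrite -[_ @^-1` _]setTI; exact: mh.
  by apply/seteqP; split => x /= H i; [move=> _|]; apply: H.
- by rewrite bigcup_const//; exists 0%N.
- move=> _ _ [A mA ->] [B mB ->]; exists (fun i => A i `&` B i).
    by move=> i; exact: measurableI.
  apply/seteqP; split => x /=; first by move=> [HA HB] i; split.
  by move=> H; split=> i; have [] := H i.
- by move=> _ [A mA ->]; exact: mn.
- have /(_ measurableT _ mE) :
    measurable_fun setT (id : g_sigma_algebraType G -> T).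
    apply: univ => i _ A mA; rewrite setTI; apply: sub_sigma_algebra.
    exists (fun j => if j == i then A else setT).
      by move=> j; case: ifP.
    apply/seteqP; split => x /=.
      by move=> Ax j; case: eqP => // ->.
    by move=> /(_ i); rewrite eqxx.
  by rewrite setTI.
Qed.

(** * Symmetries of product laws *)

Section ProductLaw.
Context {R : realType} {d : nat}.
Local Notation T := (d.-tuple (measurableTypeR R)).
Implicit Types (S : pred 'I_d) (p : T * T) (eps : {ffun 'I_d -> bool}).

Definition box (A : 'I_d -> set (measurableTypeR R)) : set T :=
  [set x | forall i, A i (tnth x i)].

Lemma measurable_box A : (forall i, measurable (A i)) -> measurable (box A).
Proof.
move=> mA.
rewrite (_ : box A = \bigcap_(i in [set: 'I_d]) ((fun x : T => tnth x i) @^-1` A i)).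
  apply: fin_bigcap_measurable => // i _.
  by rewrite -[_ @^-1` _]setTI; exact: measurable_tnth.
by apply/seteqP; split => x /= H i; [move=> _|]; apply: H.
Qed.

Definition reflect eps (x : T) : T := [tuple (-1) ^+ eps i * tnth x i | i < d].

Definition mix S p : T := [tuple if S i then tnth p.2 i else tnth p.1 i | i < d].

Lemma tnth_mix S p i :
  tnth (mix S p) i = if S i then tnth p.2 i else tnth p.1 i.
Proof. exact: tnth_mktuple. Qed.

Lemma tnth_reflect eps x i : tnth (reflect eps x) i = (-1) ^+ eps i * tnth x i.
Proof. exact: tnth_mktuple. Qed.

Definition swap S p : T * T := (mix S p, mix (predC S) p).

Lemma measurable_reflect eps : measurable_fun setT (reflect eps).
Proof.
apply/measurable_fun_tnthP => i.
rewrite (_ : _ \o _ = (fun x => (-1) ^+ eps i * tnth x i)).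
  apply: (@measurable_funM _ _ _ _ (cst ((-1) ^+ eps i)) (fun x : T => tnth x i)).
    exact: measurable_cst.
  exact: measurable_tnth.
by apply/funext => x /=; rewrite tnth_mktuple.
Qed.

Lemma measurable_mix S : measurable_fun setT (mix S).
Proof.
apply/measurable_fun_tnthP => i.
rewrite (_ : _ \o _ = (tnth (T := R))^~ i \o (if S i then snd else fst)).
  apply: measurableT_comp; first exact: measurable_tnth.
  by case: (S i).
by apply/funext => x /=; rewrite tnth_mktuple; case: (S i).
Qed.

Lemma measurable_swap S : measurable_fun setT (swap S).
Proof. by apply: measurable_fun_pair; exact: measurable_mix. Qed.

Variables (mu_ : 'I_d -> probability (measurableTypeR R) R) (mu : probability T R).
Hypothesis mu_prod : is_product_measure mu mu_.

(** On boxes, this is the evenness of each marginal. *)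
Lemma reflect_preserving eps : (forall i, even_measure (mu_ i)) ->
  measure_preserving mu mu (reflect eps).
Proof.
move=> mu_even; have mr := measurable_reflect eps; split => // E mE.
pose r_mfun : {mfun T >-> T} := HB.pack (reflect eps)
  (isMeasurableFun.Build _ _ _ _ _ mr).
apply/esym.
apply: (@eq_measure_cylinders _ _ _ _ (fun i (x : T) => tnth x i)
  mu (pushforward mu r_mfun)) => //.
- by rewrite ltey_eq (fin_num_measure mu).
- by move=> i; exact: measurable_tnth.
- by move=> d1 U k mk; exact/measurable_fun_tnthP.
move=> A mA; apply/esym; rewrite /pushforward/=.
rewrite [RHS]mu_prod//.
transitivity (mu (box (fun i => (fun t : R => (-1) ^+ eps i * t) @^-1` A i))).
  congr (mu _); apply/seteqP; split=> x /= H i; have := H i;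
  by rewrite tnth_mktuple.
rewrite [LHS]mu_prod.
  apply: eq_bigr => i _; case: (eps i) => /=.
    by rewrite expr1 -[RHS]mu_even//; congr (mu_ i _); apply/seteqP; split=> x /=;
      rewrite mulN1r.
  by rewrite expr0; congr (mu_ i _); apply/seteqP; split=> x /=; rewrite mul1r.
move=> i; rewrite -[_ @^-1` _]setTI.
have mc : measurable_fun [set: measurableTypeR R]
    (fun t : R => (-1) ^+ eps i * t).
  exact: (@measurable_funM _ _ _ _ (cst ((-1) ^+ eps i)) id).
exact: (mc measurableT _ (mA i)).
Qed.

(** Exchanging the coordinates in [S] between the two points only permutes the
    2 d one-dimensional factors of the measure of a product of two boxes. *)
Lemma swap_preserving S : measure_preserving (mu \x mu)%E (mu \x mu)%E (swap S).
Proof.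
have mu_box A : (forall i, measurable (A i)) ->
    mu (box A) = (\prod_(i < d) mu_ i (A i))%E := @mu_prod A.
have mumu_box A B : (forall i, measurable (A i)) -> (forall i, measurable (B i)) ->
    (mu \x mu)%E (box A `*` box B) =
    (\prod_(i < d) (mu_ i (A i) * mu_ i (B i)))%E.
  move=> mA mB; rewrite big_split/= -!mu_box//.
  by apply: product_measure1E; exact: measurable_box.
have ms := measurable_swap S; split => // E mE.
pose s_mfun : {mfun (T * T)%type >-> (T * T)%type} := HB.pack (swap S)
  (isMeasurableFun.Build _ _ _ _ _ ms).
pose h (i : 'I_d + 'I_d) (p : T * T) : measurableTypeR R :=
  match i with inl j => tnth p.1 j | inr j => tnth p.2 j end.
have hE (A : 'I_d + 'I_d -> set (measurableTypeR R)) :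
    [set p | forall i, A i (h i p)] = box (A \o inl) `*` box (A \o inr).
  apply/seteqP; split => p /=.
    by move=> H; split=> i; [exact: (H (inl i))|exact: (H (inr i))].
  by move=> [H1 H2] [i|i]; [exact: H1 | exact: H2].
apply/esym.
apply: (@eq_measure_cylinders _ _ _ _ h (mu \x mu)%E
  (pushforward (mu \x mu)%E s_mfun)) => //.
- have : ((mu \x mu) (setT `*` setT) < +oo)%E.
    rewrite product_measure1E//.
    by rewrite lte_mul_pinfty ?ltey_eq ?(fin_num_measure mu).
  by rewrite setXTT.
- case=> i; apply: (measurableT_comp (measurable_tnth i)) => //.
- move=> d1 U k mk; apply/measurable_fun_pairP; split;
    apply/measurable_fun_tnthP => i; [exact: (mk (inl i))|exact: (mk (inr i))].
move=> A mA; apply/esym; rewrite hE /pushforward.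
transitivity ((mu \x mu)%E
    (box (fun i => if S i then A (inr i) else A (inl i)) `*`
     box (fun i => if S i then A (inl i) else A (inr i)))).
  congr ((mu \x mu)%E _); apply/seteqP; split=> p /= [H1 H2]; split=> i;
    have := H1 i; have := H2 i; rewrite ?tnth_mktuple /=; by case: (S i).
apply: etrans (mumu_box _ _ _ _) _; try by move=> i; case: ifP.
apply/esym; apply: etrans (mumu_box _ _ _ _) _ => [i|i|/=]; try exact: mA.
by apply: eq_bigr => i _; case: (S i); rewrite // muleC.
Qed.

Lemma fst_preserving : measure_preserving (mu \x mu)%E mu fst.
Proof.
split=> // A mA; rewrite (_ : fst @^-1` A = A `*` setT).
  apply: etrans (product_measure1E mu mu mA measurableT) _.
  by rewrite -[RHS]mule1; congr (_ * _)%E; exact: probability_setT.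
by apply/seteqP; split=> x /=; [|case].
Qed.

Lemma mix_preserving S : measure_preserving (mu \x mu)%E mu (mix S).
Proof. exact: measure_preserving_comp (swap_preserving S) fst_preserving. Qed.

End ProductLaw.

(** * Monotonicity of unconditional coordinatewise quasi-concave functions *)

Section UnconditionalQuasiConcave.
Context {R : realType} {d : nat}.
Implicit Types (f : d.-tuple R -> R) (x : d.-tuple R) (i : 'I_d).

Lemma tnth_set_coord x i t j :
  tnth (set_coord x i t) j = if j == i then t else tnth x j.
Proof. by rewrite tnth_mktuple. Qed.

(** If |s| <= |t| then s lies between - t and t, where the section takes equal
    values by symmetry; quasi-concavity bounds it below by this value at s. *)
Lemma unconditional_antitone f x i (s t : R) :
  unconditional f -> coordinatewise_quasi_concave f -> `|s| <= `|t| ->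
  f (set_coord x i t) <= f (set_coord x i s).
Proof.
move=> fu fq st; have [t0|t0] := eqVneq t 0.
  by move: st; rewrite t0 normr0 normr_le0 => /eqP ->.
have fN : f (set_coord x i (- t)) = f (set_coord x i t).
  rewrite (fu [ffun j => j == i] (set_coord x i t)); congr f.
  apply: eq_from_tnth => j; rewrite [RHS]tnth_mktuple !tnth_set_coord ffunE.
  by case: eqP => _; rewrite ?expr1 ?expr0 ?mulN1r ?mul1r.
(* The weight for which s = l t + (1 - l) (- t). *)
pose l := (1 + s / t) / 2.
have st1 : `|s / t| <= 1.
  by rewrite normrM normfV ler_pdivrMr ?normr_gt0// mul1r.
have l01 : 0 <= l <= 1.
  by move: st1; rewrite ler_norml /l => /andP[? ?]; apply/andP; split; lra.
have := fq i x t (- t) l l01.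
rewrite /section fN minxx.
suff -> : l * t + (1 - l) * - t = s by [].
by rewrite /l; field.
Qed.

(** The base points [x] and [z] may differ: in the coupling below, the i-th
    coordinate takes the same two values in both factors while the other
    coordinates do not agree. *)
Lemma increments_mul_ge0 f g x z i (s t : R) :
  unconditional f -> coordinatewise_quasi_concave f ->
  unconditional g -> coordinatewise_quasi_concave g ->
  0 <= (f (set_coord x i s) - f (set_coord x i t)) *
       (g (set_coord z i s) - g (set_coord z i t)).
Proof.
move=> fu fq gu gq; have [st|/ltW ts] := lerP `|s| `|t|.
  by apply: mulr_ge0; rewrite subr_ge0; exact: unconditional_antitone.
by apply: mulr_le0; rewrite subr_le0; exact: unconditional_antitone.
Qed.

End UnconditionalQuasiConcave.

(** * The correlation inequality *)

Section Harris.
Context {R : realType} {d : nat}.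
Local Notation T := (d.-tuple (measurableTypeR R)).
Implicit Types (S : pred 'I_d) (p : T * T).
Variables (mu_ : 'I_d -> probability (measurableTypeR R) R) (mu : probability T R).
Hypothesis mu_prod : is_product_measure mu mu_.
Variables f g : T -> R.
Hypotheses (f2 : f \in Lfun mu 2%:E) (g2 : g \in Lfun mu 2%:E).

(** With the notation of the introduction, E[f(X) g(Z_S)]. *)
Let coupled S : R := \int[(mu \x mu)%E]_p (f p.1 * g (mix S p)).

Let Lfun1_coupled (u v : T * T -> T) :
  measure_preserving (mu \x mu)%E mu u -> measure_preserving (mu \x mu)%E mu v ->
  (fun p => f (u p) * g (v p)) \in Lfun (mu \x mu)%E 1.
Proof.
move=> up vp.
exact: (Lfun2_mul_Lfun1 (measure_preserving_Lfun2 up f2)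
  (measure_preserving_Lfun2 vp g2)).
Qed.

(** Let S' be S with i added and X' be X with its i-th coordinate replaced by that
    of Y.  The exchange of the i-th coordinates of X and Y swaps X with X' and
    Z_S with Z_S', so that the decrease equals both
    E[f(X) (g(Z_S) - g(Z_S'))] and E[f(X') (g(Z_S') - g(Z_S))]; the sum of the two
    integrands is (f(X) - f(X')) (g(Z_S) - g(Z_S')). *)
Lemma coupled_le i S : ~~ S i ->
  unconditional f -> coordinatewise_quasi_concave f ->
  unconditional g -> coordinatewise_quasi_concave g ->
  coupled (predU1 i S) <= coupled S.
Proof.
move=> Si fu fq gu gq.
pose S' : pred 'I_d := predU1 i S.
pose q : pred 'I_d := pred1 i.
pose tau := swap q : T * T -> T * T.
have tauP := swap_preserving mu_prod q.
have fstP := fst_preserving mu.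
have mixP U := mix_preserving mu_prod U.
have tauS p : mix S (tau p) = mix S' p.
  apply: eq_from_tnth => j; rewrite !tnth_mix /S' /q /=.
  by have [->|] := eqVneq j i; [rewrite (negbTE Si)|case: (S j)].
have tauS' p : mix S' (tau p) = mix S p.
  apply: eq_from_tnth => j; rewrite !tnth_mix /S' /q /=.
  by have [->|] := eqVneq j i; [rewrite (negbTE Si)|case: (S j)].
pose F (u : T * T -> T) U p := f (u p) * g (mix U p).
have iF u U : measure_preserving (mu \x mu)%E mu u ->
    (mu \x mu)%E.-integrable setT (EFin \o F u U).
  by move=> uP; apply/Lfun1_integrable; exact: Lfun1_coupled.
have eq_tau U V : (forall p, mix U (tau p) = mix V p) ->
    \int[(mu \x mu)%E]_p F (mix q) V p = coupled U.
  move=> UV; rewrite /coupled /Rintegral.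
  rewrite -[in RHS](measure_preserving_integral tauP (iF fst U fstP)).
  by congr fine; apply: eq_integral => p _; rewrite /F /= UV.
have : 0 <= \int[(mu \x mu)%E]_p
    ((F fst S p - F fst S' p) + (F (mix q) S' p - F (mix q) S p)).
  apply: Rintegral_ge0 => p _.
  have E (a b c e : R) : (a * c - a * e) + (b * e - b * c) = (a - b) * (c - e).
    by ring.
  rewrite /F E.
  have e1 : p.1 = set_coord p.1 i (tnth p.1 i).
    by apply: eq_from_tnth => j; rewrite tnth_set_coord; case: eqP => // ->.
  have e2 : mix q p = set_coord p.1 i (tnth p.2 i).
    apply: eq_from_tnth => j; rewrite tnth_mix [RHS]tnth_set_coord /q /=.
    by have [->|//] := eqVneq j i.
  have e3 : mix S p = set_coord (mix S p) i (tnth p.1 i).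
    apply: eq_from_tnth => j; rewrite [RHS]tnth_set_coord.
    by have [->|//] := eqVneq j i; rewrite tnth_mix (negbTE Si).
  have e4 : mix S' p = set_coord (mix S p) i (tnth p.2 i).
    apply: eq_from_tnth => j; rewrite [RHS]tnth_set_coord !tnth_mix /S' /=.
    by have [->|//] := eqVneq j i.
  have := increments_mul_ge0 p.1 (mix S p) i (tnth p.1 i) (tnth p.2 i) fu fq gu gq.
  by rewrite -e1 -e2 -e3 -e4.
rewrite RintegralD//=; last 2 first.
- exact: (integrableB measurableT (iF _ S fstP) (iF _ S' fstP)).
- exact: (integrableB measurableT (iF _ S' (mixP q)) (iF _ S (mixP q))).
rewrite !RintegralB//; try exact: iF.
rewrite (eq_tau _ _ tauS) (eq_tau _ _ tauS').
rewrite -/(coupled S) -/(coupled S').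
by rewrite -mulr2n pmulrn_lge0// subr_ge0.
Qed.

Theorem harris_covariance_ge0 :
  unconditional f -> coordinatewise_quasi_concave f ->
  unconditional g -> coordinatewise_quasi_concave g ->
  (0 <= covariance mu f g)%E.
Proof.
move=> fu fq gu gq.
have fstP := fst_preserving mu.
have f1 := Lfun2_Lfun1 f2.
have g1 := Lfun2_Lfun1 g2.
have fg1 := Lfun2_mul_Lfun1 f2 g2.
have [if1 ig1 ifg1] : [/\ mu.-integrable setT (EFin \o f),
    mu.-integrable setT (EFin \o g) & mu.-integrable setT (EFin \o (f \* g))].
  by split; exact/Lfun1_integrable.
(* Coordinates are added to S one at a time. *)
pose S k : pred 'I_d := fun j => (j < k)%N.
have mono k : (k <= d)%N -> coupled (S k) <= coupled (S 0).
  elim: k => [//|k IH] kd; apply: le_trans (IH (ltnW kd)).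
  suff -> : coupled (S k.+1) = coupled (predU1 (Ordinal kd) (S k)).
    by apply: coupled_le => //; rewrite /S /= ltnn.
  apply: eq_Rintegral => p _; congr (_ * g _).
  apply: eq_from_tnth => j; rewrite !tnth_mix /=.
  by rewrite /S ltnS leq_eqVlt -val_eqE.
have c0 : coupled (S 0) = \int[mu]_x (f x * g x).
  rewrite /Rintegral -(measure_preserving_integral fstP ifg1).
  congr fine; apply: eq_integral => p _ /=; congr (_ * g _)%:E.
  by apply: eq_from_tnth => j; rewrite tnth_mix.
have cd : coupled (S d) = \int[mu]_x f x * \int[mu]_x g x.
  have sndP : measure_preserving (mu \x mu)%E mu (snd : T * T -> T).
    rewrite (_ : snd = mix (S d)); first exact: mix_preserving mu_prod _.
    by apply/funext => p; apply: eq_from_tnth => j; rewrite tnth_mix /S ltn_ord.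
  transitivity (\int[(mu \x mu)%E]_p (f p.1 * g p.2)).
    apply: eq_Rintegral => p _; congr (_ * g _).
    by apply: eq_from_tnth => j; rewrite tnth_mix /S ltn_ord.
  have i12 := Lfun1_coupled fstP sndP.
  rewrite /Rintegral -integral12_prod_meas1; last exact/Lfun1_integrable.
  rewrite -RintegralZr//; congr fine; apply: eq_integral => x _.
  rewrite /fubini_F /= EFinM /Rintegral fineK; last exact: integrable_fin_num.
  under eq_integral do rewrite EFinM.
  by rewrite integralZl.
rewrite covarianceE// unlock.
rewrite -[X in (X - _)%E]fineK; last exact: integrable_fin_num.
rewrite -[X in (_ - X * _)%E]fineK; last exact: integrable_fin_num.
rewrite -[X in (_ - _ * X)%E]fineK; last exact: integrable_fin_num.
rewrite -EFinM -EFinB lee_fin subr_ge0.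
by have := mono d (leqnn d); rewrite c0 cd.
Qed.

End Harris.

(** * Symmetrization under reflections *)

Section Symmetrization.
Context {R : realType} {d : nat}.
Implicit Types (f g : d.-tuple R -> R) (x : d.-tuple R) (i : 'I_d).
Implicit Types eps : {ffun 'I_d -> bool}.

Lemma logconcave_quasi_concave f :
  logconcave f -> coordinatewise_quasi_concave f.
Proof.
move=> [phi [phi_conv fE]] i x s t l l01; rewrite /section !fE.
have -> : set_coord x i (l * s + (1 - l) * t) =
    [tuple l * tnth (set_coord x i s) j + (1 - l) * tnth (set_coord x i t) j
       | j < d].
  apply: eq_from_tnth => j; rewrite [RHS]tnth_mktuple !tnth_set_coord.
  by case: eqP => // _; ring.
have := phi_conv (set_coord x i s) (set_coord x i t) l l01.
set z := [tuple _ | _ < _]; set a := phi (set_coord x i s).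
set b := phi (set_coord x i t) => zab.
have /andP[l0 l1] := l01.
rewrite ge_min !ler_expR !lerN2.
have [ab|/ltW ba] := leP a b; apply/orP; [right|left]; nra.
Qed.

Lemma coordinatewise_convexP g i x (s t l : R) :
  coordinatewise_convex g -> 0 <= l <= 1 ->
  g (set_coord x i (l * s + (1 - l) * t)) <=
  l * g (set_coord x i s) + (1 - l) * g (set_coord x i t).
Proof.
move=> gc /andP[l0 l1].
by apply: (gc i x (Itv01 l0 l1)); rewrite inE.
Qed.

Definition symmetrize g : d.-tuple R -> R :=
  \sum_(eps : {ffun 'I_d -> bool}) (g \o reflect eps).

(** Composing with a reflection permutes the terms of the sum. *)
Lemma symmetrize_unconditional g : unconditional (symmetrize g).
Proof.
move=> eps x; rewrite /symmetrize !fct_sumE.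
have addK : involutive
    (fun eps' : {ffun 'I_d -> bool} => [ffun i => eps' i (+) eps i]).
  by move=> e; apply/ffunP => i; rewrite !ffunE addbK.
rewrite (reindex_inj (inv_inj addK)) /=.
apply: eq_bigr => e _ /=; congr g; apply: eq_from_tnth => i.
rewrite !tnth_reflect ffunE mulrA -exprD.
by case: (e i); case: (eps i); rewrite /= ?expr0 ?expr1// expr2 mulrNN mulr1.
Qed.

Lemma reflect_set_coord eps x i (t : R) :
  reflect eps (set_coord x i t) =
  set_coord (reflect eps x) i ((-1) ^+ eps i * t).
Proof.
apply: eq_from_tnth => j; rewrite [RHS]tnth_set_coord !tnth_reflect.
by rewrite [tnth (set_coord _ _ _) _]tnth_set_coord; case: eqP => // ->.
Qed.

(** Along a coordinate, each term of [symmetrize g] is a section of [g] composed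
    with plus or minus the identity, hence convex; so is their sum, and a concave
    function is quasi-concave. *)
Lemma symmetrize_quasi_concave g : coordinatewise_convex g ->
  coordinatewise_quasi_concave (\- symmetrize g).
Proof.
move=> gc i x s t l l01; have /andP[l0 l1] := l01.
rewrite /section /=.
have : symmetrize g (set_coord x i (l * s + (1 - l) * t)) <=
    l * symmetrize g (set_coord x i s) + (1 - l) * symmetrize g (set_coord x i t).
  rewrite /symmetrize !fct_sumE !mulr_sumr -big_split /=.
  apply: ler_sum => eps _ /=; rewrite !reflect_set_coord.
  rewrite mulrDr !(mulrCA ((-1) ^+ eps i)).
  exact: coordinatewise_convexP.
set z := symmetrize g _; set a := symmetrize g _; set b := symmetrize g _ => zab.
rewrite ge_min !lerN2.
have [ab|/ltW ba] := leP a b; apply/orP; [right|left]; nra.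
Qed.

Lemma unconditionalN f : unconditional f -> unconditional (\- f).
Proof. by move=> fu eps x /=; congr (- _); exact: fu. Qed.

Local Notation T := (d.-tuple (measurableTypeR R)).
Variables (mu_ : 'I_d -> probability (measurableTypeR R) R) (mu : probability T R).
Hypothesis mu_prod : is_product_measure mu mu_.
Hypothesis mu_even : forall i, even_measure (mu_ i).
Variables f g : T -> R.
Hypotheses (f2 : f \in Lfun mu 2%:E) (g2 : g \in Lfun mu 2%:E).

Let Lfun2_reflect eps : g \o reflect eps \in Lfun mu 2%:E.
Proof. exact: (measure_preserving_Lfun2 (reflect_preserving mu_prod eps mu_even)). Qed.

Lemma Lfun2_symmetrize : symmetrize g \in Lfun mu 2%:E.
Proof. exact: Lfun2_sum. Qed.

(** Since f = f o r for every reflection r, each term Cov(f, g o r) equals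
    Cov(f o r, g o r), which is Cov(f, g) by invariance of [mu]. *)
Lemma covariance_symmetrize : unconditional f ->
  covariance mu f (symmetrize g) =
  (#|{ffun 'I_d -> bool}|%:R%:E * covariance mu f g)%E.
Proof.
move=> fu; rewrite covariance_sumr//.
have /fineK covE : covariance mu f g \is a fin_num.
  by apply: covariance_fin_num;
    [exact: Lfun2_Lfun1|exact: Lfun2_Lfun1|exact: Lfun2_mul_Lfun1].
transitivity (\sum_(eps : {ffun 'I_d -> bool}) (fine (covariance mu f g))%:E)%E.
  apply: eq_bigr => eps _; rewrite covE.
  rewrite -[RHS](covariance_measure_preserving
    (reflect_preserving mu_prod eps mu_even))//.
  by congr covariance; apply/funext => x /=; exact: fu.
by rewrite sumEFin sumr_const -[X in X%:E = _]mulr_natl EFinM covE.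
Qed.

End Symmetrization.

(** * The covariance inequalities *)

Local Open Scope ereal_scope.

Theorem theorem1p9 (R : realType) (d : nat)
    (mu_ : 'I_d -> probability (measurableTypeR R) R)
    (mu : probability (d.-tuple (measurableTypeR R)) R)
    (f g : d.-tuple R -> R)
    (mu_prod : is_product_measure mu mu_)
    (f_std : standing_assumptions mu f)
    (g_std : standing_assumptions mu g) :
  ((forall i, even_measure (mu_ i)) ->
   (forall i, logconcave_measure (mu_ i)) ->
   unconditional f -> logconcave f ->
   coordinatewise_convex g ->
   covariance mu f g <= 0)
  /\
  (unconditional f -> coordinatewise_quasi_concave f ->
   unconditional g -> coordinatewise_quasi_concave g ->
   0 <= covariance mu f g).
Proof.
have [[f2 _ _] [g2 _ _]] := (f_std, g_std); split; last first.
  exact: (harris_covariance_ge0 mu_prod).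
move=> mu_even _ fu flc gc.
have G2 := Lfun2_symmetrize mu_prod mu_even g2.
have : 0 <= covariance mu f (\- symmetrize g)%R.
  apply: (harris_covariance_ge0 mu_prod) => //.
  - by rewrite rpredN.
  - exact: logconcave_quasi_concave.
  - exact/unconditionalN/symmetrize_unconditional.
  - exact: symmetrize_quasi_concave.
rewrite covarianceNr; [|exact: Lfun2_Lfun1|exact: Lfun2_Lfun1|exact: Lfun2_mul_Lfun1].
rewrite (covariance_symmetrize mu_prod mu_even f2 g2 fu) oppe_ge0.
by rewrite pmule_rle0// lte_fin ltr0n; apply/card_gt0P; exists [ffun=> false].
Qed.
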